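(* Let $p$ be an odd prime, let $F$ be the field of $p$ elements, let $G$ be a finite abelian $p$-group, and let $\eta$ be an automorphism of $G$ of order $2$. Put $G_\eta=\{g\in G\mid \eta(g)=g\}$ and let $x\mapsto x^{\circledast}$ be the $F$-linear extension of $\eta$ to the group algebra $FG$. Let $V(FG)$ be the group of normalized units of $FG$, and let $$V_{\circledast}(FG)=\{x\in V(FG)\mid x^{\circledast}=x^{-1}\},\qquad S_{\circledast}(FG)=\{x\in V(FG)\mid x^{\circledast}=x\}.$$ Let $$G=\langle a_1\rangle\times\cdots\times\langle a_l\rangle\times\cdots\times\langle a_t\rangle$$ be a decomposition of $G$ into a direct product of cyclic groups such that $\eta(a_i)=a_i^{-1}$ for $i\le l$ and $\eta(a_i)=a_i$ for $l<i\le t$. Let $q_i$ be the order of $a_i$, and let $L$ be the set of all $t$-tuples $\alpha=(\alpha_1,\dots,\alpha_t)$ of integers with $\alpha_i\in\{0,1,\dots,q_i-1\}$ such that at least one $\alpha_j$ is not divisible by $p$. Write $L=L_0\cup L_1\cup L_2$ (disjoint union), where $\alpha\in L$ belongs to $L_0$, $L_1$ or $L_2$ according to whether the integer $\alpha_1+\alpha_2+\cdots+\alpha_l$ is $0$, odd, or even and positive, respectively. For $\alpha\in L$ put $$u_\alpha=1+(a_1-1)^{\alpha_1}(a_2-1)^{\alpha_2}\cdots(a_t-1)^{\alpha_t}\in V(FG).$$ Then the following hold. 1. For every $i\ge 1$, the number of factors of order $p^i$ in a decomposition of $V_{\circledast}(FG)$ into a direct product of nontrivial cyclic groups equals $$\tfrac12\left(|G^{p^{i-1}}|-2|G^{p^{i}}|+|G^{p^{i+1}}|-|G_\eta^{p^{i-1}}|+2|G_\eta^{p^{i}}|-|G_\eta^{p^{i+1}}|\right),$$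 and the set $\{u_\alpha^{\circledast}u_\alpha^{-1}\mid \alpha\in L_1\}$ is a basis of $V_{\circledast}(FG)$, that is, $V_{\circledast}(FG)$ is the (internal) direct product $$V_{\circledast}(FG)=\prod_{\alpha\in L_1}\langle u_\alpha^{\circledast}u_\alpha^{-1}\rangle .$$ 2. For every $i\ge 1$, the number of factors of order $p^i$ in a decomposition of $S_{\circledast}(FG)$ into a direct product of nontrivial cyclic groups equals $$\tfrac12\left(|G^{p^{i-1}}|-2|G^{p^{i}}|+|G^{p^{i+1}}|+|G_\eta^{p^{i-1}}|-2|G_\eta^{p^{i}}|+|G_\eta^{p^{i+1}}|\right),$$ and the set $\{u_\alpha^{\circledast}u_\alpha\mid\alpha\in L_2\}\cup\{u_\alpha\mid\alpha\in L_0\}$ is a basis of $S_{\circledast}(FG)$, that is, $S_{\circledast}(FG)$ is the (internal) direct product $$S_{\circledast}(FG)=\prod_{\alpha\in L_2}\langle u_\alpha^{\circledast}u_\alpha\rangle\times\prod_{\alpha\in L_0}\langle u_\alpha\rangle .$$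
   Context: For $x=\sum_{g\in G}\alpha_g g\in FG$, $x^{\circledast}=\sum_{g\in G}\alpha_g\,\eta(g)$. The group of normalized units is $V(FG)=\{\sum_{g\in G}\alpha_g g\in FG\mid \sum_{g\in G}\alpha_g=1\}$; since $G$ is a finite $p$-group and $F$ has characteristic $p$, every such element is a unit. $S_{\circledast}(FG)$ and $V_{\circledast}(FG)$ are called the groups of symmetric and of unitary (normalized) units. For an abelian group $H$ (written multiplicatively) and $k\ge 0$, $H^{p^k}=\{h^{p^k}\mid h\in H\}$; in particular $G_\eta^{p^k}=(G_\eta)^{p^k}$. A basis of a finite abelian $p$-group $H$ is a family of nontrivial elements, with different indices giving different elements, such that $H$ is the internal direct product of the cyclic subgroups they generate. Exponent $0$ means the factor $(a_i-1)^0=1$. A decomposition of $G$ of the stated form (with $0\le l\le t$) always exists because $p$ is odd. *)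

(* Defs.v *)
From HB Require Import structures.
From mathcomp Require Import all_boot all_order all_algebra all_fingroup all_solvable all_field.

Set Implicit Arguments.
Unset Strict Implicit.
Unset Printing Implicit Defensive.

Import GroupScope GRing.Theory.
Local Open Scope ring_scope.

(* The group algebra of the whole finite group [gT] over [R]: an element is its
   coefficient function. [galg] is an alias of [{ffun gT -> R}], from which it
   inherits only the R-module structure; its product is the convolution, not
   the pointwise product of [{ffun gT -> R}]. *)
Definition galg (R : nzRingType) (gT : finGroupType) : Type := {ffun gT -> R}.

Definition gcoef (R : nzRingType) (gT : finGroupType) (x : galg R gT) (g : gT) :
    R :=
  (x : {ffun gT -> R}) g.

(* Locked so that unification does not unfold the algebra operations. *)
HB.lock Definition gbase (R : nzRingType) (gT : finGroupType) (g : gT) : galg R gT :=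
  [ffun h => (h == g)%:R].

HB.lock Definition galg_mul (R : nzRingType) (gT : finGroupType) (x y : galg R gT) :
    galg R gT :=
  [ffun g => \sum_h gcoef x h * gcoef y (h^-1 * g)%g].

Section GroupAlgebra.
Variables (R : nzRingType) (gT : finGroupType).
Local Notation FG := (galg R gT).
Local Notation gbase := (@gbase R gT).
Local Notation galg_mul := (@galg_mul R gT).

HB.instance Definition _ := GRing.Lmodule.copy FG {ffun gT -> R^o}.

Lemma galgP (x y : FG) : gcoef x =1 gcoef y -> x = y.
Proof. by move=> e; apply/ffunP. Qed.

Lemma gcoefD x y g : gcoef (x + y) g = gcoef x g + gcoef y g.
Proof. by rewrite /gcoef ffunE. Qed.

Lemma gcoefZ c x g : gcoef (c *: x) g = c * gcoef x g.
Proof. by rewrite /gcoef ffunE. Qed.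

Lemma gcoef_base h g : gcoef (gbase h) g = (g == h)%:R.
Proof. by rewrite gbase.unlock /gcoef ffunE. Qed.

Lemma gcoef_sum I (r : seq I) (P : pred I) (E : I -> FG) g :
  gcoef (\sum_(i <- r | P i) E i) g = \sum_(i <- r | P i) gcoef (E i) g.
Proof.
by elim/big_rec2: _ => [|i y x _ <-]; [rewrite /gcoef ffunE | rewrite gcoefD].
Qed.

Lemma gcoef_mul x y g :
  gcoef (galg_mul x y) g = \sum_h gcoef x h * gcoef y (h^-1 * g)%g.
Proof. by rewrite galg_mul.unlock /gcoef ffunE. Qed.

Fact galg_mulA : associative galg_mul.
Proof.
move=> x y z; apply: galgP => g; rewrite !gcoef_mul.
under eq_bigr do rewrite gcoef_mul big_distrr /=.
under [RHS]eq_bigr do rewrite gcoef_mul big_distrl /=.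
rewrite [RHS]exchange_big; apply: eq_bigr => h _ /=.
rewrite [RHS](reindex_inj (mulgI h)) /=; apply: eq_bigr => k _.
by rewrite mulKg invMg !mulgA mulrA.
Qed.

Fact galg_mul1 : left_id (gbase 1) galg_mul.
Proof.
move=> x; apply: galgP => g; rewrite gcoef_mul (bigD1 1%g) //= big1 => [|h /negPf nh].
  by rewrite gcoef_base eqxx mul1r invg1 mul1g addr0.
by rewrite gcoef_base nh mul0r.
Qed.

Fact galg_mulr1 : right_id (gbase 1) galg_mul.
Proof.
move=> x; apply: galgP => g; rewrite gcoef_mul (bigD1 g) //= big1 => [|h nh].
  by rewrite gcoef_base mulVg eqxx mulr1 addr0.
by rewrite gcoef_base -eq_mulVg1 (negPf nh) mulr0.
Qed.

Fact galg_mulDl : left_distributive galg_mul +%R.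
Proof.
move=> x y z; apply: galgP => g; rewrite gcoefD !gcoef_mul -big_split.
by apply: eq_bigr => h _; rewrite gcoefD mulrDl.
Qed.

Fact galg_mulDr : right_distributive galg_mul +%R.
Proof.
move=> x y z; apply: galgP => g; rewrite gcoefD !gcoef_mul -big_split.
by apply: eq_bigr => h _; rewrite gcoefD mulrDr.
Qed.

Fact galg_1neq0 : gbase 1 != 0.
Proof.
apply/eqP=> /(congr1 (@gcoef R gT ^~ 1%g))/eqP.
by rewrite gcoef_base eqxx /gcoef ffunE oner_eq0.
Qed.

HB.instance Definition _ := GRing.Zmodule_isNzRing.Build FG
  galg_mulA galg_mul1 galg_mulr1 galg_mulDl galg_mulDr galg_1neq0.

Lemma galg_scaleAl (c : R) (x y : FG) : c *: (x * y) = (c *: x) * y.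
Proof.
apply: galgP => g; rewrite gcoefZ !gcoef_mul big_distrr /=.
by apply: eq_bigr => h _; rewrite gcoefZ mulrA.
Qed.

HB.instance Definition _ := GRing.Lmodule_isLalgebra.Build R FG galg_scaleAl.

Definition aug (x : FG) : R := \sum_g gcoef x g.

(* The linear extension of [eta] to the group algebra. *)
Definition circledast (eta : gT -> gT) (x : FG) : FG :=
  \sum_g gcoef x g *: gbase (eta g).

Lemma gbaseM g h : gbase g * gbase h = gbase (g * h)%g.
Proof.
apply: galgP => k; rewrite gcoef_mul (bigD1 g) //= big1 => [|i /negPf ni].
  by rewrite !gcoef_base eqxx mul1r addr0 (can2_eq (mulKVg g) (mulKg g)).
by rewrite gcoef_base ni mul0r.
Qed.

Lemma gbaseX g n : gbase g ^+ n = gbase (g ^+ n)%g.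
Proof. by elim: n => // n IHn; rewrite exprS IHn gbaseM expgS. Qed.

Lemma galgE (x : FG) : x = \sum_g gcoef x g *: gbase g.
Proof.
apply: galgP => g; rewrite gcoef_sum (bigD1 g) //= big1 => [|h nh].
  by rewrite gcoefZ gcoef_base eqxx mulr1 addr0.
by rewrite gcoefZ gcoef_base eq_sym (negPf nh) mulr0.
Qed.

End GroupAlgebra.

Section CommutativeCoefficients.
Variables (R : comNzRingType) (gT : finGroupType).
Local Notation FG := (galg R gT).

Lemma galg_scaleAr (c : R) (x y : FG) : c *: (x * y) = x * (c *: y).
Proof.
apply: galgP => g; rewrite gcoefZ !gcoef_mul big_distrr /=.
by apply: eq_bigr => h _; rewrite gcoefZ mulrCA.
Qed.

HB.instance Definition _ := GRing.Lalgebra_isAlgebra.Build R FG galg_scaleAr.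

End CommutativeCoefficients.

Section FiniteGroupAlgebra.
Variables (R : finNzRingType) (gT : finGroupType).
Local Notation FG := (galg R gT).

HB.instance Definition _ := Finite.copy FG {ffun gT -> R}.
HB.instance Definition _ := FinRing.isNzRing.Build FG.

(* A unit of the group algebra, as an element of its group of units; the value
   at a non-unit is irrelevant, see [to_unitK], [normalized_unit] and
   [aug_ualpha] below. *)
Definition to_unit (x : FG) : {unit FG} := insubd (1%g : {unit FG}) x.

Lemma to_unitK x : x \is a GRing.unit -> val (to_unit x) = x.
Proof. by move=> ux; rewrite /to_unit insubdK. Qed.

Definition normalized_units : {set {unit FG}} := [set v | aug (val v) == 1].

Definition unitary_units (eta : gT -> gT) : {set {unit FG}} :=
  [set v in normalized_units | circledast eta (val v) == (val v)^-1].

Definition symmetric_units (eta : gT -> gT) : {set {unit FG}} :=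
  [set v in normalized_units | circledast eta (val v) == val v].

End FiniteGroupAlgebra.

Section Decomposition.
Variables (p : nat) (gT : finGroupType) (l t : nat) (a : 'I_t -> gT).

(* alpha_i ranges over 0, ..., q_i - 1, where q_i = #[a i]. *)
Definition exponents := {dffun forall i : 'I_t, 'I_#[a i]}.

Definition Lset : {set exponents} :=
  [set alpha : exponents | [exists j, ~~ (p %| alpha j)%N]].

(* alpha_1 + ... + alpha_l; the index set is numbered from 0. *)
Definition lsum (alpha : exponents) : nat := (\sum_(i < t | i < l) alpha i)%N.

Definition Lset0 := [set alpha in Lset | lsum alpha == 0%N].
Definition Lset1 := [set alpha in Lset | odd (lsum alpha)].
Definition Lset2 := [set alpha in Lset | ~~ odd (lsum alpha) & (0 < lsum alpha)%N].

Definition ualpha (R : nzRingType) (alpha : exponents) : galg R gT :=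
  1 + \prod_(i < t) (gbase R (a i) - 1) ^+ alpha i.

End Decomposition.

(* [s] lists, without repetition, a basis of the abelian group [H]: an enumeration
   of the generators of a direct decomposition into nontrivial cyclic groups. *)
Definition is_basis (hT : finGroupType) (H : {set hT}) (s : seq hT) : Prop :=
  [/\ uniq s, 1%g \notin s & \big[dprod/1%g]_(x <- s) <[x]>%g = H].

Definition nb_factors (hT : finGroupType) (s : seq hT) (n : nat) : nat :=
  count (fun x => #[x]%g == n) s.

Definition pow_set (hT : finGroupType) (H : {set hT}) (n : nat) : {set hT} :=
  [set (h ^+ n)%g | h in H].

Definition fixed_set (gT : finGroupType) (eta : gT -> gT) : {set gT} :=
  [set g | eta g == g].

(* Over the field of p elements, every x with [aug x = 1] is a unit. Moreover
   [aug] is multiplicative, preserved by [circledast], and equal to 1 on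
   [ualpha F alpha] for alpha in L, so [to_unit] is faithful on all products
   and quotients built from these elements. *)
Section NormalizedUnits.
Variables (F : finFieldType) (p : nat) (gT : finGroupType).
Hypotheses (p_pr : prime p) (cardF : #|F| = p).
Hypotheses (pG : p.-group [set: gT]) (cG : abelian [set: gT]).
Local Notation FG := (galg F gT).

Lemma galg_comm (x y : FG) : GRing.comm x y.
Proof.
apply: galgP => g; rewrite !gcoef_mul.
rewrite (reindex_inj (inj_comp (mulgI g) invg_inj)) /=; apply: eq_bigr => h _.
have cg (u v : gT) : (u * v = v * u)%g by apply: (centsP cG); rewrite inE.
by rewrite mulrC invMg invgK -mulgA mulVg mulg1 [(g * _)%g]cg.
Qed.

Lemma galg_exp_pexp k (x : FG) :
  x ^+ (p ^ k) = \sum_g gcoef x g *: gbase F (g ^+ (p ^ k))%g.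
Proof.
have chF: p \in [pchar FG].
  by rewrite pchar_lalg (@card_finPcharP F p 1) ?expn1.
elim: k => [|k IHk]; first by rewrite {1}[x]galgE.
rewrite expnSr exprM IHk.
have: forall r : seq gT,
  (\sum_(g <- r) gcoef x g *: gbase F (g ^+ (p ^ k))%g) ^+ p
  = \sum_(g <- r) gcoef x g *: gbase F (g ^+ (p ^ k * p))%g.
  elim=> [|g r IHr]; first by rewrite !big_nil -(pFrobenius_autE chF) pFrobenius_aut0.
  rewrite !big_cons -(pFrobenius_autE chF) pFrobenius_autD_comm; last exact: galg_comm.
  rewrite !(pFrobenius_autE chF) IHr.
  congr (_ + _); rewrite -[LHS]/((gcoef x g *: gbase F (g ^+ (p ^ k))%g) ^+ p).
  rewrite -[gcoef x g *: gbase F (g ^+ (p ^ k))%g]mulr_algl.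
  rewrite exprMn_comm; last exact: galg_comm.
  rewrite exprZn expr1n gbaseX -expgM mulr_algl.
  by rewrite -[X in gcoef x g ^+ X]cardF expf_card.
by move=> sumE; apply: sumE.
Qed.

Lemma normalized_unit (x : FG) : aug x = 1 -> x \is a GRing.unit.
Proof.
move=> ax; have [k ck] := p_natP pG.
have x1: x ^+ (p ^ k) = 1.
  rewrite galg_exp_pexp -ck.
  under eq_bigr => g _ do rewrite (expg_cardG (in_setT g)).
  by rewrite -scaler_suml -/(aug x) ax scale1r.
apply/(@unitrP FG); exists (x ^+ (p ^ k).-1); rewrite -exprS -exprSr.
by rewrite prednK ?expn_gt0 ?prime_gt0.
Qed.

Lemma normalized_unitsE :
  [set val v | v in normalized_units F gT] = [set x : FG | aug x == 1].
Proof.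
apply/setP=> x; rewrite inE; apply/imsetP/eqP => [[v + ->]|ax].
  by rewrite inE => /eqP.
have ux := normalized_unit ax.
by exists (to_unit x); rewrite ?inE to_unitK ?ax.
Qed.

Lemma augM (x y : FG) : aug (x * y) = aug x * aug y.
Proof.
rewrite /aug; under eq_bigr => g _ do rewrite gcoef_mul.
rewrite exchange_big big_distrl /=; apply: eq_bigr => h _.
rewrite (reindex_inj (mulgI h)) big_distrr /=.
by apply: eq_bigr => g _; rewrite mulKg.
Qed.

Lemma aug_sum I (r : seq I) (E : I -> FG) :
  aug (\sum_(i <- r) E i) = \sum_(i <- r) aug (E i).
Proof.
rewrite /aug; under eq_bigr => g _ do rewrite gcoef_sum.
by rewrite exchange_big.
Qed.

Lemma augZ c (x : FG) : aug (c *: x) = c * aug x.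
Proof. by rewrite /aug big_distrr; apply: eq_bigr => g _; rewrite gcoefZ. Qed.

Lemma augD (x y : FG) : aug (x + y) = aug x + aug y.
Proof. by rewrite /aug -big_split; apply: eq_bigr => g _; rewrite gcoefD. Qed.

Lemma aug_base (g : gT) : aug (gbase F g) = 1.
Proof.
rewrite /aug (bigD1 g) //= big1 => [|h nh].
  by rewrite gcoef_base eqxx addr0.
by rewrite gcoef_base (negPf nh).
Qed.

Lemma aug_circledast (eta : gT -> gT) (x : FG) : aug (circledast eta x) = aug x.
Proof.
rewrite aug_sum; apply: eq_bigr => g _.
by rewrite augZ aug_base mulr1.
Qed.

Lemma aug_ualpha t (a : 'I_t -> gT) (alpha : exponents a) :
  alpha \in Lset p a -> aug (ualpha F alpha) = 1.
Proof.
rewrite inE => /existsP[j ndv].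
have aj: (0 < alpha j)%N by case: (posnP (alpha j)) ndv => // ->; rewrite dvdn0.
have aug1: aug (1 : FG) = 1 by apply: aug_base.
rewrite augD aug1; suff: aug (\prod_(i < t) (gbase F (a i) - 1) ^+ alpha i) == 0.
  by move/eqP->; rewrite addr0.
rewrite (big_morph (@aug F gT) augM aug1) prodf_seq_eq0; apply/hasP.
exists j; rewrite ?mem_index_enum //= -(prednK aj) exprS augM augD aug_base.
by rewrite -scaleN1r augZ aug1 mulr1 subrr mul0r.
Qed.

End NormalizedUnits.

(* Main.v *)
From HB Require Import structures.
Require Import Defs.
From mathcomp Require Import all_boot all_order all_algebra all_fingroup all_solvable all_field.
From mathcomp Require Import ring zify lra.

(* Let x_i = a_i - 1 and x^b the monomial with exponents b.  The claimed basis
   elements are w = 1 + x^alpha y with y of augmentation 1, 2 or -2, that is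
   nonzero since p is odd, so that w^(p^k) = 1 + x^(p^k alpha) y^(p^k).
   - As every nonzero exponent vector is p^k alpha with alpha in L, successive
     approximation along the powers of the augmentation ideal shows that the w's
     generate V(FG).
   - The order of w is at most p^k when x^(p^k alpha) = 0, and (alpha, k) |->
     p^k alpha is injective, so the product of the orders of the w's is at most
     p^(|G| - 1) = |V(FG)|.  Hence V(FG) is the direct product of the <w>.
   Each w is unitary (alpha in L_1) or symmetric (alpha in L_0 or L_2), and the
   two subgroups meet trivially, so this decomposition splits into the required
   two.  Finally V(FG)^(p^k) consists of the normalized elements supported on
   G^(p^k), and its symmetric elements are those constant on the orbits of eta:
   counting them gives the orders of the p^k-th powers of both groups, whose
   second differences are the numbers of cyclic factors. *)

Set Implicit Arguments.
Unset Strict Implicit.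
Unset Printing Implicit Defensive.

Import GroupScope GRing.Theory.
Local Open Scope ring_scope.

(** * Units of a filtered commutative algebra *)

(** The multiples of 1 by 0, ..., p - 1 are distinct, hence exhaust F. Thus scaling by an element of
    F can be realised by a power of a unit. *)
Lemma nat_surj_prime_card (F : finFieldType) p :
  prime p -> #|F| = p -> forall c : F, exists m : nat, c = m%:R.
Proof.
move=> p_pr cF c.
have chF : p \in [pchar F] by rewrite (@card_finPcharP F p 1) ?expn1.
have inj : injective (fun i : 'I_p => i%:R : F).
  move=> i j; wlog le_ij : i j / (i <= j)%N => [IH eij|/esym/eqP].
    by have [/IH->//|/ltnW/IH->] := leqP i j.
  rewrite -subr_eq0 -natrB // -(dvdn_pcharf chF) => d.
  apply/val_inj/eqP; rewrite eqn_leq le_ij /= -subn_eq0; apply/eqP.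
  have [//|h] := posnP (j - i).
  by have := dvdn_leq h d; have := ltn_ord j; lia.
have /mapP[i _ ->] : c \in [seq i%:R | i : 'I_p].
  by rewrite (inj_card_onto inj) // cF card_ord.
by exists i.
Qed.

(** As long as p divides every entry it can be divided out; the sum of the entries drops each
    time. *)
Lemma factor_prime_power p t (b : 'I_t -> nat) : prime p ->
  (0 < \sum_i b i)%N ->
  exists k (c : 'I_t -> nat),
    (forall i, b i = p ^ k * c i)%N /\ exists j, ~~ (p %| c j)%N.
Proof.
move=> p_pr; have [n] := ubnP (\sum_i b i)%N.
elim: n b => // n IH b lt_n b_gt0.
have [/forallP dv|/forallPn[j ndv]] := boolP [forall i, (p %| b i)%N].
- have sE : (\sum_i b i = p * \sum_i (b i %/ p))%N.
    by rewrite big_distrr /=; apply: eq_bigr => i _; rewrite mulnC divnK.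
  have p_gt1 := prime_gt1 p_pr.
  have [||k [c [cE ndv]]] := IH (fun i => (b i %/ p)%N); try nia.
  by exists k.+1, c; split=> // i; rewrite -(divnK (dv i)) cE expnS; lia.
- by exists 0%N, b; split=> [i|]; [rewrite mul1n | exists j].
Qed.

Section Generation.
Variables (F : fieldType) (p : nat) (R : comNzRingType) (aug : {rmorphism R -> F}).
Variables (t : nat) (x : 'I_t -> R) (q : 'I_t -> nat).
Hypotheses (p_pr : prime p) (natF : forall c : F, exists m : nat, c = m%:R).
Hypotheses (chR : p \in [pchar R]) (xq : forall i, x i ^+ q i = 0).

Definition monomial (b : 'I_t -> nat) : R := \prod_i x i ^+ b i.

(** This is the n-th power of the ideal generated by the x_i, presented inductively so that proofs
    can proceed one monomial multiple at a time. *)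
Inductive filtration (n : nat) : R -> Prop :=
| filtration0 : filtration n 0
| filtrationD y z : filtration n y -> filtration n z -> filtration n (y + z)
| filtrationM b y : (n <= \sum_i b i)%N -> filtration n (monomial b * y).

Hypothesis aug_ker : forall y, aug y = 0 -> filtration 1 y.

Lemma monomialD b c : monomial (fun i => b i + c i)%N = monomial b * monomial c.
Proof. by rewrite /monomial -big_split; apply: eq_bigr => i _; rewrite exprD. Qed.

Lemma monomialX b n : monomial b ^+ n = monomial (fun i => n * b i)%N.
Proof. by rewrite /monomial -prodrXl; apply: eq_bigr => i _; rewrite mulnC exprM. Qed.

Lemma monomial_eq0 b i : (q i <= b i)%N -> monomial b = 0.
Proof.
by move=> le; rewrite /monomial (bigD1 i) //= -(subnKC le) exprD xq !mul0r.
Qed.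

(** In characteristic p, raising to the power p^k is additive. *)
Lemma one_plus_monomialX b y k :
  (1 + monomial b * y) ^+ (p ^ k)
  = 1 + monomial (fun i => p ^ k * b i)%N * y ^+ (p ^ k).
Proof.
rewrite exprDn_pchar ?expr1n ?exprMn ?monomialX //.
by rewrite pnatX (pnatE _ p_pr) chR.
Qed.

Lemma filtration_mulr n y z : filtration n y -> filtration n (y * z).
Proof.
elim=> [|u v _ IHu _ IHv|b u le_b]; first by rewrite mul0r; apply: filtration0.
  by rewrite mulrDl; apply: filtrationD.
by rewrite -mulrA; apply: filtrationM.
Qed.

Lemma filtrationMM m n y z :
  filtration m y -> filtration n z -> filtration (m + n) (y * z).
Proof.
move=> Jy; elim=> [|u v _ IHu _ IHv|c v le_c].
- by rewrite mulr0; apply: filtration0.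
- by rewrite mulrDr; apply: filtrationD.
elim: Jy => [|u w _ IHu _ IHw|b u le_b].
- by rewrite mul0r; apply: filtration0.
- by rewrite mulrDl; apply: filtrationD.
rewrite mulrACA -monomialD; apply: filtrationM.
by rewrite big_split leq_add.
Qed.

Lemma filtration_le m n y : (m <= n)%N -> filtration n y -> filtration m y.
Proof.
move=> le_mn; elim=> [|u v _ IHu _ IHv|b u le_b]; first exact: filtration0.
  exact: filtrationD.
exact/filtrationM/(leq_trans le_mn).
Qed.

Lemma filtrationN n y : filtration n y -> filtration n (- y).
Proof. by move=> Jy; rewrite -mulrN1; apply: filtration_mulr. Qed.

(** In such a high degree some exponent reaches q_i, where x_i^(q_i) = 0. Successive approximation
    therefore stops after finitely many steps. *)
Lemma filtration_vanish n y : (\sum_i q i < n)%N -> filtration n y -> y = 0.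
Proof.
move=> lt_n; elim=> [|u v _ -> _ ->|b u le_b]; rewrite ?addr0 //.
have [/existsP[i le_i]|/existsPn nle] := boolP [exists i, (q i <= b i)%N].
  by rewrite (monomial_eq0 le_i) mul0r.
suff: (\sum_i b i <= \sum_i q i)%N by lia.
by apply: leq_sum => i _; have := nle i; lia.
Qed.

(** [W] stands for a subgroup of the units, given as a predicate on R so that its elements can be
    compared with ring expressions. [W_gen] provides, for each vector of L, a member with a
    prescribed leading monomial and a nonzero leading coefficient. *)
Variable W : R -> Prop.
Hypotheses (W1 : W 1) (WM : forall v w, W v -> W w -> W (v * w)).
Hypothesis WV : forall v, W v -> exists2 w, W w & v * w = 1.
Hypothesis W_gen : forall al : 'I_t -> nat, (forall i, al i < q i)%N ->
  (exists j, ~~ (p %| al j)%N) ->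
  exists2 y, aug y != 0 & W (1 + monomial al * y).

Lemma W_X v n : W v -> W (v ^+ n).
Proof. by move=> Wv; elim: n => // n IHn; rewrite exprS; apply: WM. Qed.

(** Modulo degree n + 1 the units 1 + z multiply as the z add, so one monomial multiple is treated
    at a time. In degree exactly n its exponent vector is p^k times a vector of L, and a power of
    the unit from [W_gen] has the right leading term. *)
Lemma filtration_step n z : (0 < n)%N -> filtration n z ->
  exists2 v, W v & filtration n.+1 (v - (1 + z)).
Proof.
move=> n_gt0; elim=> [|y y' Jy [v Wv Jv] Jy' [v' Wv' Jv']|b y le_b].
- by exists 1; rewrite ?addr0 ?subrr //; apply: filtration0.
- exists (v * v'); first exact: WM.
  have ->: v * v' - (1 + (y + y'))
      = (v - (1 + y)) * v' + ((v' - (1 + y')) * (1 + y) + y * y') by ring.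
  apply: filtrationD; first exact: filtration_mulr.
  apply: filtrationD; first exact: filtration_mulr.
  by apply: filtration_le (filtrationMM Jy Jy'); lia.
have [gt_b|le_b'] := ltnP n (\sum_i b i)%N.
  exists 1 => //; have ->: 1 - (1 + monomial b * y) = monomial b * - y by ring.
  exact: filtrationM.
have b_gt0 : (0 < \sum_i b i)%N by lia.
have [k [al [bE ndv]]] := factor_prime_power p_pr b_gt0.
have [/existsP[i le_i]|/existsPn nle] := boolP [exists i, (q i <= b i)%N].
  exists 1 => //; rewrite (monomial_eq0 le_i) mul0r addr0 subrr.
  exact: filtration0.
have [i|y0 ay0 Wy0] := W_gen _ ndv.
  have := nle i; rewrite -ltnNge; apply: leq_ltn_trans.
  by rewrite bE leq_pmull // expn_gt0 prime_gt0.
have mE : monomial (fun i => p ^ k * al i)%N = monomial b.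
  by apply: eq_bigr => i _; rewrite bE.
have WE : (1 + monomial al * y0) ^+ (p ^ k) = 1 + monomial b * y0 ^+ (p ^ k).
  by rewrite one_plus_monomialX mE.
set y1 := y0 ^+ (p ^ k) in WE.
have ay1 : aug y1 != 0 by rewrite rmorphXn expf_neq0.
(* The exponent m is chosen so that m y1 - y has augmentation 0, which gains one degree. *)
have [m mE'] := natF (aug y / aug y1).
exists ((1 + monomial b * y1) ^+ m); first by rewrite -WE; do 2!apply: W_X.
(* Binomial expansion to first order: the remaining terms have degree at least 2n > n. *)
have {WE Wy0 mE}J2 j : filtration n.+1 ((1 + monomial b * y1) ^+ j - (1 + monomial b * (y1 *+ j))).
  have Jb : filtration n (monomial b) by rewrite -[monomial b]mulr1; apply: filtrationM.
  elim: j => [|j IHj]; first by rewrite expr0 mulr0n mulr0 addr0 subrr; apply: filtration0.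
  have ->: (1 + monomial b * y1) ^+ j.+1 - (1 + monomial b * (y1 *+ j.+1)) =
     ((1 + monomial b * y1) ^+ j - (1 + monomial b * (y1 *+ j))) * (1 + monomial b * y1)
     + (monomial b * monomial b) * (y1 *+ j * y1).
    by rewrite exprSr mulrSr; ring.
  apply: filtrationD; apply: filtration_mulr => //.
  by apply: filtration_le (filtrationMM Jb Jb); lia.
have ->: (1 + monomial b * y1) ^+ m - (1 + monomial b * y)
   = ((1 + monomial b * y1) ^+ m - (1 + monomial b * (y1 *+ m)))
     + monomial b * (y1 *+ m - y) by ring.
apply: filtrationD => //; rewrite -addn1; apply: filtrationMM.
  by rewrite -[monomial b]mulr1; apply: filtrationM.
by apply: aug_ker; rewrite raddfB raddfMn /= -mulr_natl -mE' divfK // subrr.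
Qed.

Lemma filtration_generates v : aug v = 1 -> W v.
Proof.
move=> av; suff: forall n, exists2 w, W w & filtration n.+1 (v - w).
  move/(_ (\sum_i q i)%N) => [w Ww /(filtration_vanish (ltnSn _))/eqP].
  by rewrite subr_eq0 => /eqP->.
elim=> [|n [w Ww Jn]].
  by exists 1 => //; apply: aug_ker; rewrite rmorphB rmorph1 av subrr.
(* With w' the inverse of w, v / w = 1 + (v - w) w'; approximating this quotient one degree further
   corrects w. *)
have [w' Ww' ww'] := WV Ww.
have [v' Wv' Jv'] := filtration_step (ltn0Sn n) (filtration_mulr w' Jn).
exists (w * v'); first exact: WM.
have ->: v - w * v' = - ((v' - (1 + (v - w) * w')) * w) + (1 - w * w') * (v - w) by ring.
rewrite ww' subrr mul0r addr0.
exact/filtrationN/filtration_mulr.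
Qed.

End Generation.

(** * Direct products of cyclic p-groups *)

Lemma pow_set_exp0 p (hT : finGroupType) (H : {set hT}) : pow_set H (p ^ 0) = H.
Proof.
by rewrite /pow_set (eq_imset _ (g := id)) ?imset_id // => h; rewrite expg1.
Qed.

Lemma lognXorder (hT : finGroupType) p (x : hT) n : prime p -> p.-elt x ->
  logn p #[x ^+ (p ^ n)]%g = (logn p #[x]%g - n)%N.
Proof.
move=> p_pr px; have [m xm] := p_natP px.
rewrite orderXgcd xm pfactorK //.
have [le|lt] := leqP n m.
  rewrite (gcdn_idPr _) ?dvdn_exp2l // -expnB ?prime_gt0 ?pfactorK //.
rewrite (gcdn_idPl _) ?dvdn_exp2l 1?ltnW // divnn expn_gt0 prime_gt0 //= logn1.
by lia.
Qed.

(** Taking p^n-th powers respects direct products, and a cyclic factor of order p^m contributes p^(m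
    - n); truncated subtraction covers m < n. *)
Lemma logn_card_Mho (hT : finGroupType) p (H : {group hT}) s n : prime p ->
  p.-group H -> \big[dprod/1%g]_(x <- s) <[x]>%g = H ->
  logn p #|'Mho^n(H)| = (\sum_(x <- s) (logn p #[x]%g - n))%N.
Proof.
move=> p_pr; elim: s H => [|x s IHs] H pH.
  rewrite !big_nil => H1; have ->: 'Mho^n(H) = 1%g.
    by apply/trivgP; rewrite (subset_trans (Mho_sub n H)) // -H1.
  by rewrite cards1 logn1.
rewrite !big_cons => dH; have [[_ K _ eK] _ _ _] := dprodP dH.
rewrite eK in dH; have /mulG_sub[/= sxH sKH] := dprodW dH.
have px : p.-elt x by apply: pgroupS pH.
rewrite -(dprod_card (Mho_dprod n dH)) lognM ?cardG_gt0 //.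
rewrite (Mho_p_cycle n px) -orderE lognXorder // (IHs K) //.
exact: pgroupS pH.
Qed.

Lemma logn_pow_set (hT : finGroupType) p (H : {group hT}) s n : prime p ->
  p.-group H -> abelian H -> is_basis H s ->
  logn p #|pow_set H (p ^ n)| = (\sum_(x <- s) (logn p #[x]%g - n))%N.
Proof.
move=> p_pr pH cH [_ _ dH].
by rewrite -(logn_card_Mho n p_pr pH dH) (MhoEabelian n pH cH).
Qed.

(** As a function of i, max(m - i, 0) has second difference 1 at i = m and 0 elsewhere. The form
    without subtraction stays in the natural numbers. *)
Lemma nb_factorsE (hT : finGroupType) p (H : {group hT}) s i : prime p ->
  p.-group H -> abelian H -> is_basis H s -> (0 < i)%N ->
  (nb_factors s (p ^ i) + 2 * logn p #|pow_set H (p ^ i)|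
   = logn p #|pow_set H (p ^ i.-1)| + logn p #|pow_set H (p ^ i.+1)|)%N.
Proof.
move=> p_pr pH cH bs i_gt0; rewrite !(logn_pow_set _ p_pr pH cH bs).
have [_ _ dH] := bs.
have ps : {in s, forall x, p.-elt x}.
  move=> x xs; apply: pgroupS pH; rewrite -(bigdprodWY dH) sub_gen //.
  by rewrite (big_rem x) //= subsetUl.
rewrite /nb_factors -sum1_count big_mkcond big_distrr -!big_split /=.
apply: eq_big_seq => x /ps px.
have [m xm] := p_natP px; rewrite xm pfactorK //.
by rewrite eqn_exp2l ?prime_gt1 //; case: eqP => ?; lia.
Qed.

(** Multiplication from the Cartesian product of the cyclic groups to V is onto, and the bound on
    the orders forces it to be injective. *)
Lemma bigdprod_cycles (hT : finGroupType) (I : finType) (L : {set I})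
    (w : I -> hT) (V : {group hT}) :
  abelian V -> (forall i, i \in L -> w i \in V) ->
  V \subset <<w @: L>>%g -> (\prod_(i in L) #[w i]%g <= #|V|)%N ->
  \big[dprod/1%g]_(i in L) <[w i]>%g = V.
Proof.
move=> cV wV genV leV; apply: bigcprod_card_dprod => //.
rewrite (bigcprodEY _ cV) => [|i Li]; last by rewrite cycle_subG wV.
apply/eqP; rewrite eqEsubset; apply/andP; split.
  rewrite bigprodGE gen_subG; apply/bigcupsP=> i Li.
  by rewrite cycle_subG wV.
apply: subset_trans genV _; rewrite bigprodGE genS //.
apply/subsetP=> _ /imsetP[i Li ->]; apply/bigcupP; exists i => //.
exact: cycle_id.
Qed.

(** A repeated generator would lie in one factor and in the product of the others, hence be
    trivial. *)
Lemma is_basis_intro (hT : finGroupType) (H : {group hT}) s :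
  1%g \notin s -> \big[dprod/1%g]_(x <- s) <[x]>%g = H -> is_basis H s.
Proof.
move=> s1 dH; split=> //; elim: s H s1 dH => // x s IHs H.
rewrite inE negb_or big_cons => /andP[x1 s1] dH.
have [[_ K _ eK] _ _ tiK] := dprodP dH.
rewrite /= (IHs K) // andbT; apply/negP=> xs.
have xK : x \in K.
  rewrite -(bigdprodWY eK) mem_gen // (big_rem x) //=.
  by rewrite inE cycle_id.
have: x \in (<[x]> :&: K)%g by rewrite inE cycle_id.
by rewrite -eK tiK inE eq_sym (negPf x1).
Qed.

(** Since |S| |T| <= |V| = |A| |B|, neither inclusion can be strict. *)
Lemma dprod_split_card (hT : finGroupType) (A B S T V : {group hT}) :
  A \x B = V -> A \subset S -> B \subset T -> S \subset V -> T \subset V ->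
  S :&: T = 1%g -> A :=: S /\ B :=: T.
Proof.
move=> dV sAS sBT sSV sTV tiST.
have leV : (#|S| * #|T| <= #|V|)%N.
  by rewrite -(TI_cardMg tiST) subset_leq_card // mul_subG.
have eV := dprod_card dV.
have leA := subset_leq_card sAS; have leB := subset_leq_card sBT.
have A0 := cardG_gt0 A; have B0 := cardG_gt0 B.
have SA : (#|S| <= #|A|)%N by rewrite -(leq_pmul2r B0) eV (leq_trans _ leV) // leq_mul2l leB orbT.
have TB : (#|T| <= #|B|)%N by rewrite -(leq_pmul2l A0) eV (leq_trans _ leV) // leq_mul2r leA orbT.
by split; apply/eqP; rewrite eqEcard ?sAS ?sBT.
Qed.

(** The modular law applies to ['Mho^n(V)], the product of ['Mho^n(A)] and ['Mho^n(B)], because the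
    first factor meets B trivially. *)
Lemma Mho_dprod_setIr (hT : finGroupType) (A B V : {group hT}) n :
  A \x B = V -> 'Mho^n(B) = ('Mho^n(V) :&: B)%g.
Proof.
move=> dV; have [_ _ _ tiAB] := dprodP dV.
rewrite -(dprodW (Mho_dprod n dV)).
have cAB : commute 'Mho^n(A) 'Mho^n(B).
  have [_ _ cMM _] := dprodP (Mho_dprod n dV).
  exact/esym/centC.
rewrite cAB -group_modl ?Mho_sub //.
have ->: ('Mho^n(A) :&: B = 1)%g.
  by apply/trivgP; rewrite -tiAB setSI ?Mho_sub.
by rewrite mulg1.
Qed.

Lemma bigdprod_setU (hT : finGroupType) (I : finType) (A B : {set I})
    (E : I -> {set hT}) : [disjoint A & B] ->
  \big[dprod/1%g]_(i in A :|: B) E i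
  = \big[dprod/1%g]_(i in A) E i \x \big[dprod/1%g]_(i in B) E i.
Proof. by move=> dAB; rewrite -bigU //; apply: eq_bigl => i; rewrite inE. Qed.

(** * Counting the multiples p^k alpha of exponent vectors alpha in L *)

Section ExponentCount.
Variables (p : nat) (gT : finGroupType) (t : nat) (a : 'I_t -> gT).
Hypothesis p_pr : prime p.
Local Notation L := (Lset p a).

Definition exponent0 : exponents a :=
  [ffun i : 'I_t => Ordinal (order_gt0 (a i))].

(** An entry out of range falls back to [al i]; the map is used only where every entry is in
    range. *)
Definition scale_exponent (k : nat) (al : exponents a) : exponents a :=
  [ffun i : 'I_t => insubd (al i) (p ^ k * al i)%N].

Lemma scale_exponentE k (al : exponents a) i : (p ^ k * al i < #[a i]%g)%N ->
  scale_exponent k al i = (p ^ k * al i)%N :> nat.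
Proof. by move=> lt; rewrite ffunE val_insubd lt. Qed.

(** If k < k', cancelling p^k would make every entry of [al] divisible by p, against [al \in L]. *)
Lemma scale_exponent_inj k k' (al al' : exponents a) :
  al \in L -> al' \in L ->
  (forall i, (p ^ k * al i < #[a i]%g)%N) ->
  (forall i, (p ^ k' * al' i < #[a i]%g)%N) ->
  scale_exponent k al = scale_exponent k' al' -> k = k' /\ al = al'.
Proof.
wlog le_k : k k' al al' / (k <= k')%N => [IH La La' lt lt' e|].
  have [/IH|/ltnW/IH] := leqP k k'; first exact.
  by case/(_ _ _ La' La lt' lt (esym e)) => -> ->.
rewrite inE => /existsP[j ndv] _ lt lt' e.
have alE i : al i = (p ^ (k' - k) * al' i)%N :> nat.
  have := congr1 (fun f : exponents a => f i : nat) e.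
  rewrite /= !scale_exponentE // -{1}(subnKC le_k) expnD -mulnA => /eqP.
  by rewrite eqn_pmul2l ?expn_gt0 ?prime_gt0 // => /eqP.
have k0 : (k' - k = 0)%N.
  case: (k' - k)%N alE => // d alE; case/negP: ndv.
  by rewrite alE expnS -mulnA dvdn_mulr.
split; first by lia.
by apply/ffunP=> i; apply/val_inj; rewrite /= alE k0 mul1n.
Qed.

(** [e al] will be the logarithm to base p of the order of the basis unit attached to [al]. *)
Variable e : exponents a -> nat.
Hypothesis e_lt : forall al k, al \in L -> (k < e al)%N ->
  forall i, (p ^ k * al i < #[a i]%g)%N.

Local Notation P := [set x : {al : exponents a & 'I_(e al)} | tag x \in L].
Local Notation f := (fun x : {al : exponents a & 'I_(e al)} =>
  scale_exponent (tagged x) (tag x)).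

Lemma card_scaled : #|f @: P| = (\sum_(al in L) e al)%N.
Proof.
rewrite card_in_imset.
  rewrite -sum1_card (eq_bigl (fun x => (tag x \in L) && true)); last first.
    by move=> x; rewrite inE andbT.
  rewrite -(sig_big_dep (I := exponents a) (J := fun al => 'I_(e al))
     (fun al => al \in L) (fun _ _ => true) (fun _ _ => 1%N)).
  by apply: eq_bigr => al _; rewrite sum1_card card_ord.
move=> [al k] [al' k']; rewrite inE /= => La; rewrite inE /= => La' eq_f.
have [||ek ea] := scale_exponent_inj La La' _ _ eq_f; try exact: e_lt.
by move: k k' ek {eq_f La La'}; rewrite ea => k k' /val_inj ->.
Qed.

Lemma scaled_neq0 : exponent0 \notin f @: P.
Proof.
apply/imsetP=> -[[al k]]; rewrite inE /= => La eq0.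
have := La; rewrite inE => /existsP[j]; case/negP.
have := congr1 (fun h : exponents a => h j : nat) eq0.
rewrite /= ffunE scale_exponentE; last by apply: e_lt.
move/esym/eqP; rewrite muln_eq0 expn_eq0 => /orP[/andP[/eqP p0]|/eqP->//].
by have := prime_gt0 p_pr; rewrite p0.
Qed.

(** The pairs (al, k) with k < [e al] inject into the nonzero exponent vectors. *)
Lemma sum_exponents_le : (\sum_(al in L) e al <= #|exponents a|.-1)%N.
Proof.
rewrite -card_scaled -(cardsC1 exponent0) subset_leq_card //.
by rewrite subsetC sub1set inE scaled_neq0.
Qed.

Lemma sum_exponents_lt al0 : al0 \in L -> e al0 = 0%N ->
  (\sum_(al in L) e al < #|exponents a|.-1)%N.
Proof.
move=> La0 e0; rewrite -card_scaled -(cardsC1 exponent0) proper_card //.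
rewrite properE subsetC sub1set inE scaled_neq0 /=.
apply/subsetPn; exists al0.
  rewrite in_setC1; apply: contraL La0 => /eqP->; rewrite inE.
  by apply/existsPn=> j; rewrite negbK ffunE dvdn0.
apply/imsetP=> -[[al k]]; rewrite inE /= => La eqa.
have [i|i||k0 ea] := scale_exponent_inj (k := 0) (k' := k) La0 La.
- by rewrite mul1n.
- exact: e_lt La (ltn_ord k) i.
- rewrite -eqa; apply/ffunP=> i; apply/ord_inj.
  by rewrite scale_exponentE mul1n.
by case: k {k0 eqa}; rewrite -ea e0.
Qed.

End ExponentCount.

(** * Elements of the group algebra invariant under an involution *)

Section InvariantCount.
Variables (F : finFieldType) (gT : finGroupType) (e : gT -> gT) (A : {set gT}).
Hypotheses (eK : involutive e) (eA : forall g, (e g \in A) = (g \in A)).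

(** Elements supported on [A] and constant on the orbits of [e]; for [e] the identity only the
    support condition remains. *)
Definition invariant_elts : {set galg F gT} :=
  [set x | [forall g, ((gcoef x g != 0) ==> (g \in A))
                      && (gcoef x (e g) == gcoef x g)]].

Lemma invariant_eltsP (x : galg F gT) :
  reflect ((forall g, g \notin A -> gcoef x g = 0)
           /\ forall g, gcoef x (e g) = gcoef x g)
          (x \in invariant_elts).
Proof.
rewrite inE; apply: (iffP forallP) => [H|[H1 H2] g].
  split=> g; have /andP[/implyP h1 /eqP h2] := H g => // nA.
  by apply/eqP; apply: contraNT nA.
rewrite H2 eqxx andbT; apply/implyP; apply: contraNT => nA.
by rewrite H1.
Qed.

Definition orbit_reps : {set gT} :=
  [set g in A | (enum_rank g <= enum_rank (e g))%N].

(** The representatives and their images under [e] cover [A] and meet exactly in the fixed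
    points. *)
Lemma card_orbit_reps :
  (2 * #|orbit_reps| = #|A| + #|[set g in A | e g == g]|)%N.
Proof.
have mem_im g : (g \in e @: orbit_reps) = (e g \in orbit_reps).
  by rewrite -{1}[g]eK (mem_imset _ _ (inv_inj eK)).
have eqA : orbit_reps :|: e @: orbit_reps = A.
  apply/setP=> g; rewrite in_setU mem_im !inE eA eK -andb_orr.
  by rewrite leq_total andbT.
have eqI : orbit_reps :&: e @: orbit_reps = [set g in A | e g == g].
  apply/setP=> g; rewrite in_setI mem_im !inE eA eK.
  case: (g \in A) => //=; rewrite -eqn_leq eq_sym.
  by apply/eqP/eqP=> [/ord_inj/enum_rank_inj|->].
have := cardsUI orbit_reps (e @: orbit_reps).
by rewrite eqA eqI card_imset ?addnn ?mul2n //; exact: inv_inj.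
Qed.

Lemma card_invariant_elts : #|invariant_elts| = (#|F| ^ #|orbit_reps|)%N.
Proof.
rewrite -[#|F|]/#|{: F}| -(card_pffun_on (0 : F)).
(* An invariant element is a free choice of values on the representatives, spread over the orbits.
   As f vanishes off the representatives, [ext f] vanishes outside [A]. *)
pose ext (f : {ffun gT -> F}) : galg F gT :=
  [ffun g => if g \in orbit_reps then f g else f (e g)].
have fN (f : {ffun gT -> F}) g : f \in pffun_on 0 orbit_reps F ->
    g \notin orbit_reps -> f g = 0.
  by case/pffun_onP=> /subsetP sf _ nT; apply/eqP; apply: contraNT nT => /sf.
have extE f g : gcoef (ext f) g = if g \in orbit_reps then f g else f (e g).
  by rewrite /gcoef ffunE.
have reps_inj g : g \in orbit_reps -> e g \in orbit_reps -> e g = g.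
  rewrite !inE eK => /andP[_ le1] /andP[_ le2].
  by apply/enum_rank_inj/ord_inj/eqP; rewrite eqn_leq le2.
have reps_A g : g \in A -> (g \in orbit_reps) || (e g \in orbit_reps).
  by move=> Ag; rewrite !inE eA Ag eK leq_total.
rewrite -(card_in_imset (f := ext) (D := pffun_on 0 orbit_reps F)).
  congr #|pred_of_set _|; apply/setP=> x; apply/invariant_eltsP/imsetP.
    case=> xA xe; exists [ffun g => if g \in orbit_reps then gcoef x g else 0].
      apply/pffun_onP; split=> //; apply/subsetP=> g.
      by rewrite inE ffunE; case: ifP; rewrite ?eqxx.
    apply: galgP => g; rewrite extE; case: ifP => [Tg|nT]; rewrite ffunE ?Tg //.
    case: ifP => [_|nT']; first by rewrite xe.
    by apply: xA; apply/negP=> /reps_A; rewrite nT nT'.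
  case=> f Tf ->; split=> g.
    move=> nA; rewrite extE ifN ?(fN _ _ Tf) // !inE ?eA ?(negPf nA) //.
  rewrite !extE eK; case: ifP => [Teg|nTeg]; case: ifP => [Tg|nTg] //.
    by rewrite reps_inj.
  by rewrite !(fN _ _ Tf) ?nTg ?nTeg.
move=> f f' Tf Tf' ef; apply/ffunP=> g.
have [Tg|nTg] := boolP (g \in orbit_reps); last by rewrite !fN.
by have := congr1 (@gcoef F gT ^~ g) ef; rewrite /= !extE Tg.
Qed.

Hypotheses (e1 : e 1%g = 1%g) (A1 : 1%g \in A).

Lemma invariant_eltsD x y : x \in invariant_elts -> y \in invariant_elts ->
  x + y \in invariant_elts.
Proof.
case/invariant_eltsP=> xA xe /invariant_eltsP[yA ye].
apply/invariant_eltsP; split=> g => [nA|]; rewrite !gcoefD ?xe ?ye //.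
by rewrite xA // yA // addr0.
Qed.

Lemma invariant_eltsZ c x : x \in invariant_elts -> c *: x \in invariant_elts.
Proof.
case/invariant_eltsP=> xA xe.
apply/invariant_eltsP; split=> g => [nA|]; rewrite !gcoefZ ?xe //.
by rewrite xA // mulr0.
Qed.

Lemma invariant_elts1 : 1 \in invariant_elts.
Proof.
apply/invariant_eltsP; split=> g.
  by move=> nA; rewrite gcoef_base; case: eqP nA => // ->; rewrite A1.
by rewrite !gcoef_base -{1}e1 (inj_eq (inv_inj eK)).
Qed.

(** Adding a scalar multiple of 1 carries the fibre of the augmentation over 1 onto any other fibre,
    so all |F| fibres have the same size. *)
Lemma card_invariant_aug1 :
  #|[set x in invariant_elts | aug x == 1]| = (#|F| ^ #|orbit_reps|.-1)%N.
Proof.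
have reps1 : 1%g \in orbit_reps by rewrite inE A1 e1 leqnn.
have F0 : (0 < #|F|)%N by rewrite (cardD1 0).
apply/eqP; rewrite -(eqn_pmul2l F0) -expnS prednK; last by rewrite (cardD1 1%g) reps1.
rewrite -card_invariant_elts -(sum1_card (mem invariant_elts)).
rewrite (partition_big (@aug F gT) predT) //=.
under eq_bigr => c _.
  rewrite sum1dep_card.
  have ->: #|[set x | (x \in invariant_elts) && (aug x == c)]| =
      #|[set x in invariant_elts | aug x == 1]|.
    have aug1 : aug (1 : galg F gT) = 1 by apply: aug_base.
    rewrite -(card_imset _ (@addIr (galg F gT) ((1 - c) *: 1))).
    congr #|pred_of_set _|; apply/setP=> x; rewrite inE.
    apply/imsetP/andP => [[y + ->]|[Ix /eqP ax]].
      rewrite inE => /andP[Iy /eqP ay]; split.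
        by rewrite invariant_eltsD // invariant_eltsZ // invariant_elts1.
      rewrite augD augZ aug1 ay mulr1. by rewrite addrC subrK.
    exists (x - (1 - c) *: 1); last by rewrite subrK.
    rewrite inE -scaleNr augD augZ aug1 ax mulr1 opprB [1 + _]addrC subrK eqxx andbT.
    by rewrite invariant_eltsD // invariant_eltsZ // invariant_elts1.
  over.
by rewrite sum_nat_const.
Qed.

End InvariantCount.

(** * The group algebra of an abelian group *)

(* An alias of the group algebra carrying the proof that the group is abelian,
   so that it can be given a commutative ring structure. *)
Definition cgalg (F : finFieldType) (gT : finGroupType)
  (cG : abelian [set: gT]) : Type := galg F gT.

Section CommutativeGroupAlgebra.
Variables (F : finFieldType) (gT : finGroupType) (cG : abelian [set: gT]).

HB.instance Definition _ := GRing.Lalgebra.copy (cgalg F cG) (galg F gT).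
HB.instance Definition _ :=
  GRing.PzRing_hasCommutativeMul.Build (cgalg F cG) (@galg_comm F gT cG).

Definition caug : cgalg F cG -> F := @aug F gT.

Lemma aug1 : aug (1 : galg F gT) = 1. Proof. exact: aug_base. Qed.

Lemma augN (x : galg F gT) : aug (- x) = - aug x.
Proof. by rewrite -scaleN1r augZ mulN1r. Qed.

Fact caug_zmod_morphism : zmod_morphism caug.
Proof. by move=> x y; rewrite /caug augD augN. Qed.

Fact caug_monoid_morphism : monoid_morphism caug.
Proof. by split; [exact: aug1 | exact: augM]. Qed.

HB.instance Definition _ :=
  GRing.isZmodMorphism.Build (cgalg F cG) F caug caug_zmod_morphism.
HB.instance Definition _ :=
  GRing.isMonoidMorphism.Build (cgalg F cG) F caug caug_monoid_morphism.

Variables (p : nat).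
Hypotheses (p_pr : prime p) (cardF : #|F| = p).

Lemma pchar_cgalg : p \in [pchar cgalg F cG].
Proof. by rewrite pchar_lalg (@card_finPcharP F p 1) ?expn1. Qed.

Hypothesis pG : p.-group [set: gT].
Variables (t : nat) (a : 'I_t -> gT).
Hypothesis dG : \big[dprod/1%g]_(i < t) <[a i]>%g = [set: gT].

Definition gvar (i : 'I_t) : cgalg F cG := gbase F (a i) - 1.

(** The order q of a_i is a power of p, so (a_i - 1)^q = a_i^q - 1. *)
Lemma gvar_nilp i : gvar i ^+ #[a i]%g = 0.
Proof.
have pa : p.-elt (a i) by apply: pgroupS pG; apply: subsetT.
have [m am] := p_natP pa.
rewrite {1}am /gvar exprDn_pchar; last by rewrite pnatX (pnatE _ p_pr) pchar_cgalg.
rewrite exprNn_pchar; last by rewrite pnatX (pnatE _ p_pr) pchar_cgalg.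
rewrite expr1n -[X in X - 1]/((gbase F (a i) : galg F gT) ^+ (p ^ m)).
by rewrite gbaseX -am expg_order subrr.
Qed.

(** By gh - 1 = (g - 1)h + (h - 1), the property passes from the a_i to all their products. *)
Lemma filtration_gbase g : filtration gvar 1 ((gbase F g : cgalg F cG) - 1).
Proof.
have J1 : filtration gvar 1 ((gbase F 1 : cgalg F cG) - 1).
  by rewrite -[gbase F 1%g]/(1 : cgalg F cG) subrr; apply: filtration0.
have JM g1 g2 : filtration gvar 1 ((gbase F g1 : cgalg F cG) - 1) ->
   filtration gvar 1 ((gbase F g2 : cgalg F cG) - 1) ->
   filtration gvar 1 ((gbase F (g1 * g2)%g : cgalg F cG) - 1).
  move=> Jg1 Jg2; rewrite -gbaseM.
  have ->: (gbase F g1 * gbase F g2 : cgalg F cG) - 1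
     = ((gbase F g1 : cgalg F cG) - 1) * gbase F g2 + ((gbase F g2 : cgalg F cG) - 1).
    by rewrite mulrBl mul1r addrA subrK.
  by apply: filtrationD => //; apply: filtration_mulr.
have Ja i : filtration gvar 1 ((gbase F (a i) : cgalg F cG) - 1).
  rewrite -[X in filtration _ _ X]/(gvar i).
  have <- : monomial gvar (fun j => (j == i) : nat) * 1 = gvar i.
    rewrite mulr1 /monomial (bigD1 i) //= eqxx big1 ?mulr1 // => j /negPf->.
    by rewrite expr0.
  apply: filtrationM; rewrite (bigD1 i) //= eqxx; exact: leq_addr.
have dG' : \big[dprod/1%g]_(i < t) <[a i]>%g = [set: gT]%G by [].
have [c [ca -> _]] := mem_bigdprod dG' (in_setT g).
elim/big_ind: _ => // i _.
have /cycleP[n ->] := ca i isT.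
by elim: n => [|n IHn]; rewrite ?expg0 // expgS; apply: JM.
Qed.

(** When the coefficients y_g sum to 0, y is the sum of the y_g (g - 1). *)
Lemma aug_ker_filtration (y : cgalg F cG) : caug y = 0 -> filtration gvar 1 y.
Proof.
move=> ay.
have ->: y = \sum_g (gcoef y g)%:A * ((gbase F g : cgalg F cG) - 1).
  under eq_bigr => g _ do rewrite mulrBr mulr1 mulr_algl.
  by rewrite sumrB -scaler_suml -/(aug y) -/(caug y) ay scale0r subr0 -galgE.
elim/big_ind: _ => [||g _]; [exact: filtration0|exact: filtrationD|].
by rewrite mulrC; apply/filtration_mulr/filtration_gbase.
Qed.

Lemma ualphaE (al : exponents a) :
  ualpha F al = 1 + monomial gvar (fun i => al i : nat) :> cgalg F cG.
Proof. by []. Qed.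

End CommutativeGroupAlgebra.

(** * The involution of the group algebra induced by eta *)

Section Star.
Variables (F : finFieldType) (gT : finGroupType) (eta : gT -> gT).
Hypotheses (etaM : {morph eta : g h / (g * h)%g}) (etaK : involutive eta).
Local Notation star := (@circledast F gT eta).

Lemma gcoef_circledast x g : gcoef (star x) g = gcoef x (eta g).
Proof.
rewrite gcoef_sum (bigD1 (eta g)) //= big1 => [|h nh].
  by rewrite gcoefZ gcoef_base etaK eqxx mulr1 addr0.
rewrite gcoefZ gcoef_base eq_sym (can2_eq etaK etaK).
by rewrite (negPf nh) mulr0.
Qed.

Lemma circledastK : involutive star.
Proof. by move=> x; apply: galgP => g; rewrite !gcoef_circledast etaK. Qed.

Lemma circledastD x y : star (x + y) = star x + star y.
Proof. by apply: galgP => g; rewrite gcoefD !gcoef_circledast gcoefD. Qed.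

Lemma circledastB x y : star (x - y) = star x - star y.
Proof.
by apply: (addIr (star y)); rewrite -circledastD !subrK.
Qed.

Lemma circledast_base g : star (gbase F g) = gbase F (eta g).
Proof.
apply: galgP => h; rewrite gcoef_circledast !gcoef_base.
by rewrite (can2_eq etaK etaK).
Qed.

Lemma eta1 : eta 1 = 1%g.
Proof. by apply: (mulgI (eta 1)); rewrite -etaM !mulg1. Qed.

Lemma etaV g : eta g^-1 = (eta g)^-1%g.
Proof. by apply: (mulgI (eta g)); rewrite -etaM !mulgV eta1. Qed.

Lemma circledast1 : star 1 = 1.
Proof. by rewrite circledast_base eta1. Qed.

Lemma circledastM x y : star (x * y) = star x * star y.
Proof.
apply: galgP => g; rewrite gcoef_circledast !gcoef_mul.
rewrite (reindex_inj (inv_inj etaK)); apply: eq_bigr => h _.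
by rewrite !gcoef_circledast etaM etaV.
Qed.

Lemma circledastX x n : star (x ^+ n) = star x ^+ n.
Proof. by elim: n => [|n IHn]; rewrite ?circledast1 // !exprS circledastM IHn. Qed.

Lemma circledastV x : x \is a GRing.unit -> star x^-1 = (star x)^-1.
Proof.
move=> ux; have e : star x * star x^-1 = 1 by rewrite -circledastM divrr ?circledast1.
have e' : star x^-1 * star x = 1 by rewrite -circledastM mulVr ?circledast1.
have usx : star x \is a GRing.unit by apply/unitrP; exists (star x^-1).
by apply: (mulrI usx); rewrite divrr.
Qed.

End Star.

(** * Powers of unitary and symmetric units *)

Section Units.
Variables (p : nat) (F : finFieldType) (gT : finGroupType) (eta : gT -> gT).
Hypotheses (p_pr : prime p) (p_odd : odd p) (cardF : #|F| = p).
Hypotheses (pG : p.-group [set: gT]) (cG : abelian [set: gT]).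
Hypotheses (etaM : {morph eta : g h / (g * h)%g}) (etaK : involutive eta).
Local Notation star := (@circledast F gT eta).
Local Notation V := (normalized_units F gT).
Local Notation A k := (pow_set [set: gT] (p ^ k)).

Lemma normalized_units_group_set : group_set V.
Proof.
apply/group_setP; split=> [|u v]; rewrite !inE ?aug1 //.
by move=> /eqP au /eqP av; rewrite FinRing.val_unitM augM au av mulr1.
Qed.
Canonical normalized_units_group := Group normalized_units_group_set.

Lemma unit_group_abelian : abelian [set: {unit galg F gT}].
Proof.
by apply/centsP=> u _ v _; apply/val_inj/(@galg_comm F gT cG).
Qed.

Lemma unitary_units_group_set : group_set (unitary_units F eta).
Proof.
apply/group_setP; split=> [|u v].
  by rewrite inE group1 /= (circledast1 _ etaM etaK) invr1.
rewrite [u \in _]inE [v \in _]inE => /andP[Vu /eqP su] /andP[Vv /eqP sv].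
rewrite inE groupM // FinRing.val_unitM circledastM // su sv.
by rewrite /= -invrM ?(valP u) ?(valP v) // (galg_comm cG).
Qed.
Canonical unitary_units_group := Group unitary_units_group_set.

Lemma symmetric_units_group_set : group_set (symmetric_units F eta).
Proof.
apply/group_setP; split=> [|u v].
  by rewrite inE group1 /= (circledast1 _ etaM etaK).
rewrite [u \in _]inE [v \in _]inE => /andP[Vu /eqP su] /andP[Vv /eqP sv].
by rewrite inE groupM // FinRing.val_unitM circledastM // su sv eqxx.
Qed.
Canonical symmetric_units_group := Group symmetric_units_group_set.

Lemma unitary_sub : unitary_units F eta \subset V.
Proof. by apply/subsetP=> u; rewrite inE => /andP[]. Qed.

Lemma symmetric_sub : symmetric_units F eta \subset V.
Proof. by apply/subsetP=> u; rewrite inE => /andP[]. Qed.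

Lemma mem_powT g k : (g ^+ (p ^ k))%g \in A k.
Proof. by apply: imset_f; rewrite inE. Qed.

(** Frobenius fixes the coefficients, so x^(p^k) is the sum of the x_g g^(p^k). Conversely, an
    element supported on p^k-th powers lifts after choosing one root of each. *)
Lemma val_pow_units k : [set val v | v in pow_set V (p ^ k)]
  = [set x in invariant_elts F id (A k) | aug x == 1].
Proof.
apply/setP=> y; apply/imsetP/idP => [[v /imsetP[u Vu ->] ->]|].
  rewrite inE; apply/andP; split; last first.
    by have := groupX (p ^ k) Vu; rewrite inE.
  apply/invariant_eltsP; split=> // g nA.
  rewrite FinRing.val_unitX (galg_exp_pexp p_pr cardF cG) gcoef_sum big1 // => h _.
  rewrite gcoefZ gcoef_base; case: eqP nA => [->|]; last by rewrite mulr0.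
  by rewrite mem_powT.
rewrite inE => /andP[/invariant_eltsP[yA _] /eqP ay].
(* A chosen p^k-th root of h; the default 1 is not reached for h in [A k]. *)
pose r h : gT := odflt 1%g [pick g | (g ^+ (p ^ k) == h)%g].
have rK h : h \in A k -> (r h ^+ (p ^ k))%g = h.
  case/imsetP=> g _ ->; rewrite /r; case: pickP => [g' /eqP //|/(_ g)].
  by rewrite eqxx.
pose x : galg F gT := [ffun g => if g == r (g ^+ (p ^ k))%g
                                 then gcoef y (g ^+ (p ^ k))%g else 0].
have xE : \sum_g gcoef x g *: gbase F (g ^+ (p ^ k))%g = y.
  apply: galgP => h; rewrite gcoef_sum.
  under eq_bigr => g _ do rewrite gcoefZ gcoef_base {1}/gcoef ffunE.
  have [Ah|nAh] := boolP (h \in A k); last first.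
    rewrite yA // big1 // => g _.
    have [eh|nh] := eqVneq h (g ^+ (p ^ k))%g; last by rewrite mulr0.
    by rewrite eh mem_powT in nAh.
  rewrite (bigD1 (r h)) //= rK // !eqxx mulr1 big1 ?addr0 // => g ng.
  have [eh|nh] := eqVneq h (g ^+ (p ^ k))%g; last by rewrite mulr0.
  by rewrite -eh (negPf ng) mul0r.
have ax : aug x = 1.
  rewrite -ay -xE aug_sum; apply: eq_bigr => g _.
  by rewrite augZ aug_base mulr1.
have ux := normalized_unit p_pr cardF pG cG ax.
exists (to_unit x ^+ (p ^ k))%g.
  by apply: imset_f; rewrite inE to_unitK ?ax.
by rewrite FinRing.val_unitX to_unitK // (galg_exp_pexp p_pr cardF cG) xE.
Qed.

Lemma one_mem_powT k : 1%g \in A k.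
Proof. by apply/imsetP; exists 1%g; rewrite ?inE // expg1n. Qed.

Lemma etaX g n : eta (g ^+ n) = (eta g ^+ n)%g.
Proof. by elim: n => [|n IHn]; rewrite ?(eta1 etaM) // !expgS etaM IHn. Qed.

Lemma eta_pow_set k g : (eta g \in A k) = (g \in A k).
Proof.
have imp h : h \in A k -> eta h \in A k.
  by case/imsetP=> g' _ ->; rewrite etaX mem_powT.
by apply/idP/idP => /imp //; rewrite etaK.
Qed.

Lemma fixed_pow_set k :
  [set g in A k | eta g == g] = pow_set (fixed_set eta) (p ^ k).
Proof.
apply/setP=> h; rewrite inE; apply/andP/imsetP => [[/imsetP[g _ hE] /eqP fh]|].
  (* h is fixed, so h^2 = (g * eta g)^(p^k), and squaring is invertible. *)
  have [n cn] := p_natP pG.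
  have o2 : odd (p ^ n) by rewrite oddX p_odd orbT.
  (* Since |G| = p^n is odd, 2m = |G| + 1, so m inverts 2 modulo |G|. *)
  pose m := (p ^ n).+1./2.
  exists ((g * eta g) ^+ m)%g.
    by rewrite inE etaX etaM etaK [(eta g * g)%g](centsP cG) ?inE.
  have cgg : commute g (eta g) by apply: (centsP cG); rewrite inE.
  rewrite -expgM mulnC expgM expgMn // -etaX -hE fh -expg2 -expgM.
  rewrite /m mul2n halfK /= o2 subn0 expgS -cn.
  by rewrite (expg_cardG (in_setT h)) mulg1.
case=> g; rewrite inE => /eqP fg ->; split; first by rewrite mem_powT.
by rewrite etaX fg.
Qed.

Lemma card_pow_units k : #|pow_set V (p ^ k)| = (p ^ #|A k|.-1)%N.
Proof.
rewrite -(card_imset _ val_inj) val_pow_units card_invariant_aug1 ?one_mem_powT // cardF.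
congr (p ^ _.-1)%N; apply: eq_card => g.
by rewrite !inE leqnn andbT.
Qed.

Lemma card_normalized_units : #|V| = (p ^ #|gT|.-1)%N.
Proof. by rewrite -[V](pow_set_exp0 p) card_pow_units pow_set_exp0 cardsT. Qed.

Lemma pgroup_normalized_units : p.-group V.
Proof. by rewrite /pgroup card_normalized_units pnatX pnat_id. Qed.

Lemma abelian_normalized_units : abelian V.
Proof. exact: abelianS (subsetT _) unit_group_abelian. Qed.

(** A common element equals its own inverse, and V(FG) has odd order. *)
Lemma unitary_symmetric_TI :
  unitary_units F eta :&: symmetric_units F eta = 1%g.
Proof.
apply/trivgP/subsetP=> u; rewrite inE => /andP[].
rewrite inE => /andP[Vu /eqP su]; rewrite inE => /andP[_ /eqP su'].
have u2 : (u ^+ 2 = 1)%g.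
  apply/val_inj; rewrite FinRing.val_unitX FinRing.val_unit1 expr2.
  by rewrite -{1}su' su mulVr // (valP u).
rewrite inE -order_eq1 -dvdn1 -(eqP (_ : coprime 2 #[u]%g)) ?dvdn_gcd ?dvdnn ?andbT.
  by rewrite order_dvdn u2.
rewrite coprime2n; have [n ->] := p_natP (mem_p_elt pgroup_normalized_units Vu).
by rewrite oddX p_odd orbT.
Qed.

(** This splitting will be obtained below from the explicit basis. *)
Hypothesis dV : unitary_units F eta \x symmetric_units F eta = V.

(** A p^k-th power is determined by its values on the orbits of eta in [A k], of which there are
    half of |A k| plus the number of fixed points. The successor accounts for the coordinate lost to
    the condition of augmentation 1. *)
Lemma logn_pow_symmetric k :
  (2 * (logn p #|pow_set (symmetric_units F eta) (p ^ k)|).+1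
   = #|A k| + #|pow_set (fixed_set eta) (p ^ k)|)%N.
Proof.
(* Because the symmetric units form a direct factor, a symmetric p^k-th power in V(FG) is the p^k-th
   power of a symmetric unit. *)
have SE : pow_set (symmetric_units F eta) (p ^ k)
    = pow_set V (p ^ k) :&: symmetric_units F eta.
  have pS := pgroupS symmetric_sub pgroup_normalized_units.
  have cS := abelianS symmetric_sub abelian_normalized_units.
  rewrite /pow_set -(MhoEabelian k pS cS).
  rewrite -(MhoEabelian k pgroup_normalized_units abelian_normalized_units).
  exact: (Mho_dprod_setIr k dV).
have vE : [set val v | v in pow_set (symmetric_units F eta) (p ^ k)]
    = [set x in invariant_elts F eta (A k) | aug x == 1].
  apply/setP=> x; apply/imsetP/idP => [[v + ->]|].
    rewrite SE inE => /andP[Vv]; rewrite inE => /andP[_ /eqP sv].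
    have := imset_f val Vv; rewrite val_pow_units !inE => /andP[/forallP H ->].
    rewrite andbT; apply/forallP=> g; have /andP[-> _] := H g.
    by rewrite -(gcoef_circledast etaK) sv /=.
  rewrite inE => /andP[/invariant_eltsP[xA xe] ax].
  have : x \in [set val v | v in pow_set V (p ^ k)].
    by rewrite val_pow_units inE ax andbT; apply/invariant_eltsP.
  case/imsetP=> v Vv xv; exists v => //; rewrite SE inE Vv /= inE.
  apply/andP; split; first by rewrite inE -xv.
  by rewrite -xv; apply/eqP/galgP => g; rewrite (gcoef_circledast etaK) xe.
rewrite -(card_imset _ val_inj) vE card_invariant_aug1 ?one_mem_powT ?(eta1 etaM) //;
  last exact: eta_pow_set.
rewrite -fixed_pow_set -(card_orbit_reps etaK (eta_pow_set k)) cardF pfactorK //.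
rewrite prednK // (cardD1 1%g) inE one_mem_powT (eta1 etaM) leqnn //.
Qed.

(** The exponent for the unitary part is the one for V(FG), namely |A k| - 1, minus the one for the
    symmetric part. *)
Lemma logn_pow_unitary k :
  (2 * logn p #|pow_set (unitary_units F eta) (p ^ k)|
   + #|pow_set (fixed_set eta) (p ^ k)| = #|A k|)%N.
Proof.
have A0 : (0 < #|A k|)%N by rewrite (cardD1 1%g) one_mem_powT.
have Vl : (logn p #|pow_set V (p ^ k)| = #|A k|.-1)%N.
  by rewrite card_pow_units pfactorK.
have lE : (logn p #|pow_set (unitary_units F eta) (p ^ k)|
    + logn p #|pow_set (symmetric_units F eta) (p ^ k)|
    = logn p #|pow_set V (p ^ k)|)%N.
  have pS := pgroupS symmetric_sub pgroup_normalized_units.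
  have cS := abelianS symmetric_sub abelian_normalized_units.
  have pU := pgroupS unitary_sub pgroup_normalized_units.
  have cU := abelianS unitary_sub abelian_normalized_units.
  rewrite /pow_set -(MhoEabelian k pS cS) -(MhoEabelian k pU cU).
  rewrite -(MhoEabelian k pgroup_normalized_units abelian_normalized_units).
  by rewrite -(dprod_card (Mho_dprod k dV)) lognM ?cardG_gt0.
by have := logn_pow_symmetric k; lia.
Qed.

End Units.

(** * The basis *)

Section Basis.
Variables (p : nat) (F : finFieldType) (gT : finGroupType) (eta : gT -> gT).
Hypotheses (p_pr : prime p) (p_odd : odd p) (cardF : #|F| = p).
Hypotheses (pG : p.-group [set: gT]) (cG : abelian [set: gT]).
Hypotheses (etaM : {morph eta : g h / (g * h)%g}) (etaK : involutive eta).
Variables (l t : nat) (a : 'I_t -> gT).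
Hypothesis dG : \big[dprod/1%g]_(i < t) <[a i]>%g = [set: gT].
Hypothesis eta_inv : forall i : 'I_t, (i < l)%N -> eta (a i) = (a i)^-1%g.
Hypothesis eta_fix : forall i : 'I_t, (l <= i)%N -> eta (a i) = a i.
Local Notation star := (@circledast F gT eta).
Local Notation V := (normalized_units F gT).
Local Notation R := (cgalg F cG).
Local Notation L := (Lset p a).
Local Notation mon al := (monomial (gvar F cG a) (fun i => al i : nat)).

Lemma card_exponents : #|exponents a| = #|gT|.
Proof.
rewrite -[RHS]cardsT -(bigdprod_card (G := [set: gT]%G) dG) card_dep_ffun.
rewrite foldrE big_map big_enum /=.
by apply: eq_bigr => i _; rewrite card_ord -orderE.
Qed.

Lemma star_prod I (r : seq I) (E : I -> R) :
  star (\prod_(i <- r) E i) = (\prod_(i <- r) (star (E i) : R)) :> R.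
Proof. exact: (big_morph star (circledastM etaM etaK) (circledast1 _ etaM etaK)). Qed.

(** For i < l this is the factor in a^-1 - 1 = -a^-1 (a - 1), of augmentation -1. *)
Definition star_factor (i : 'I_t) : R :=
  if (i < l)%N then - (gbase F (a i)^-1%g : R) else 1.

Lemma star_gvar i : star (gvar F cG a i) = star_factor i * gvar F cG a i.
Proof.
rewrite /gvar (circledastB etaK) (circledast1 _ etaM etaK) (circledast_base _ etaK).
rewrite /star_factor; case: ltnP => il; last by rewrite eta_fix // mul1r.
have e : (gbase F (a i)^-1%g : R) * gbase F (a i) = 1.
  by rewrite -[LHS]/((gbase F (a i)^-1 : galg F gT) * gbase F (a i)) gbaseM mulVg.
by rewrite eta_inv // mulrBr mulr1 opprK mulNr e addrC.
Qed.

Lemma star_monomial (al : exponents a) :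
  exists2 b : R, caug b = (-1) ^+ lsum l al & star (mon al) = b * mon al.
Proof.
exists (\prod_i star_factor i ^+ al i).
  rewrite rmorph_prod /lsum -prodrXr [RHS]big_mkcond; apply: eq_bigr => i _.
  rewrite rmorphXn /star_factor; case: ifP => _ /=; last by rewrite rmorph1 expr1n.
  by rewrite rmorphN /= /caug aug_base.
rewrite /monomial star_prod -big_split; apply: eq_bigr => i _.
by rewrite (circledastX etaM etaK) star_gvar exprMn_comm //; apply: galg_comm.
Qed.

(** Merging the three families into one function on L lets V(FG) be decomposed at once; the cases
    are L_1, L_0 and L_2. *)
Definition basis_unit (al : exponents a) : {unit galg F gT} :=
  let u := ualpha F al in
  to_unit (if odd (lsum l al) then star u * u^-1
           else if lsum l al == 0%N then u else star u * u).

Lemma two_neq0 : (2 : F) != 0.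
Proof.
have chF : p \in [pchar F] by rewrite (@card_finPcharP F p 1) ?expn1.
rewrite -(dvdn_pcharf chF); apply/negP=> /(dvdn_leq (isT : (0 < 2)%N)).
by have := prime_gt1 p_pr; move: p_odd; case: (p) => [|[|[|]]].
Qed.

Lemma ualpha_unit al : al \in L -> ualpha F al \is a GRing.unit.
Proof. by move=> La; apply: (normalized_unit p_pr cardF pG cG); exact: aug_ualpha La. Qed.

Lemma augV (x : galg F gT) : aug x = 1 -> aug x^-1 = 1.
Proof.
move=> ax; have ux := normalized_unit p_pr cardF pG cG ax.
by rewrite -[LHS]mul1r -ax -augM divrr // aug1.
Qed.

Lemma basis_unit_aug al : al \in L ->
  let u := ualpha F al in
  aug (if odd (lsum l al) then star u * u^-1
           else if lsum l al == 0%N then u else star u * u) = 1.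
Proof.
move=> La u; have au : aug u = 1 by apply: aug_ualpha La.
by case: ifP => _; [|case: ifP => _]; rewrite ?augM ?aug_circledast ?augV ?au ?mulr1.
Qed.

Lemma val_basis_unit al : al \in L ->
  val (basis_unit al) = let u := ualpha F al in
    if odd (lsum l al) then star u * u^-1
           else if lsum l al == 0%N then u else star u * u.
Proof.
move=> La; rewrite to_unitK //.
by apply: (normalized_unit p_pr cardF pG cG); exact: basis_unit_aug.
Qed.

Lemma basis_unit_in al : al \in L -> basis_unit al \in V.
Proof. by move=> La; rewrite inE val_basis_unit // basis_unit_aug. Qed.

Lemma caug_monomial al : al \in L -> caug (mon al) = 0.
Proof.
move=> La; have := aug_ualpha F La; rewrite (ualphaE F cG) augD aug1.
by move/(canRL (addKr _)); rewrite addrC subrr.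
Qed.

(** Put m for the monomial and star m = b m. On L_1, (1 + bm)/(1 + m) = 1 + m(b - 1)/(1 + m) with b
    of augmentation -1; on L_2, (1 + bm)(1 + m) = 1 + m(b + 1 + bm) with b of augmentation 1. The
    cofactors have augmentation -2 and 2. *)
Lemma basis_unitE al : al \in L ->
  exists2 y : R, caug y != 0 & (val (basis_unit al) : R) = 1 + mon al * y.
Proof.
move=> La; rewrite val_basis_unit //=.
have := ualpha_unit La; have := augV (aug_ualpha F La).
rewrite (ualphaE F cG); set m := mon al => av uu.
have [b ab sm] := star_monomial al; rewrite -/m in sm.
have su : star (1 + m) = 1 + m * b :> R.
  by rewrite circledastD // (circledast1 _ etaM etaK) sm mulrC.
case: ifP => [lo|le].
  pose v : R := ((1 + m : galg F gT)^-1).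
  have uv : (1 + m) * v = 1 by exact: divrr uu.
  exists ((b - 1) * v).
    rewrite rmorphM rmorphB rmorph1 /= ab -signr_odd lo expr1 /caug av.
    by rewrite mulr1 -opprD oppr_eq0 two_neq0.
  rewrite su -[RHS]/(1 + m * ((b - 1) * v)) -[LHS]/((1 + m * b) * v).
  (* Replacing the constant term 1 by (1 + m)v turns the claim into a polynomial identity. *)
  by rewrite -{2}uv; ring.
case: ifP => l0; first by exists 1; rewrite ?mulr1 ?rmorph1 ?oner_eq0.
exists (b + 1 + m * b).
  rewrite rmorphD rmorphD rmorphM rmorph1 /= ab -signr_odd le expr0 /= caug_monomial //.
  by rewrite mul0r addr0 two_neq0.
rewrite su -[LHS]/((1 + m * b) * (1 + m) : R); ring.
Qed.

(** If some entry of p^k al reached its bound, the monomial of p^k al would vanish and the p^k-th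
    power of the unit would be 1. *)
Lemma basis_unit_lt al k : al \in L -> (k < logn p #[basis_unit al]%g)%N ->
  forall i, (p ^ k * al i < #[a i]%g)%N.
Proof.
move=> La lt i; rewrite ltnNge; apply/negP=> le.
have [y _ wE] := basis_unitE La.
have wk : (basis_unit al ^+ (p ^ k) = 1)%g.
  apply/val_inj; rewrite FinRing.val_unitX.
  have chR := pchar_cgalg cG p_pr cardF.
  have nil j : gvar F cG a j ^+ #[a j]%g = 0 by exact: (gvar_nilp cG p_pr cardF pG).
  have := one_plus_monomialX (gvar F cG a) p_pr chR (fun i => al i : nat) y k.
  by rewrite (monomial_eq0 nil le) mul0r addr0 -wE.
move: lt; rewrite ltnNge => /negP; apply.
rewrite -(pfactorK k p_pr) dvdn_leq_log ?expn_gt0 ?prime_gt0 //.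
by rewrite order_dvdn wk.
Qed.

Lemma normalized_units_sub_gen : V \subset <<basis_unit @: L>>%g.
Proof.
apply/subsetP=> v; rewrite inE => /eqP av.
pose W (z : R) := exists2 w, w \in <<basis_unit @: L>>%g & val w = z.
suff: W (val v) by case=> w Ww /val_inj <-.
apply: (filtration_generates (aug := @caug F gT cG) (p := p) (x := gvar F cG a)
   (q := fun i => #[a i]%g)) => //.
- exact: nat_surj_prime_card p_pr cardF.
- exact: pchar_cgalg.
- exact: (gvar_nilp cG p_pr cardF pG).
- exact: aug_ker_filtration dG.
- by exists 1%g; rewrite ?group1.
- by move=> _ _ [w Ww <-] [w' Ww' <-]; exists (w * w')%g; rewrite ?groupM.
- move=> _ [w Ww <-]; exists (val w^-1%g); first by exists w^-1%g; rewrite ?groupV.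
  exact: (divrr (valP w)).
move=> al lt [j ndv].
pose be : exponents a := [ffun i => Ordinal (lt i)].
have Lb : be \in L by rewrite inE; apply/existsP; exists j; rewrite ffunE.
have [y ay wE] := basis_unitE Lb; exists y => //.
exists (basis_unit be); first by rewrite mem_gen // imset_f.
by rewrite wE; congr (1 + _ * y); apply: eq_bigr => i _; rewrite ffunE.
Qed.

Lemma basis_unit_order al : al \in L ->
  #[basis_unit al]%g = (p ^ logn p #[basis_unit al]%g)%N.
Proof.
move=> La.
have pV := pgroup_normalized_units p_pr cardF pG cG.
have [n ->] := p_natP (mem_p_elt pV (basis_unit_in La)).
by rewrite pfactorK.
Qed.

(** The units generate, and counting exponent vectors bounds the product of their orders by p^(|G| -
    1) = |V(FG)|. *)
Lemma dprod_basis_unit : \big[dprod/1%g]_(al in L) <[basis_unit al]>%g = V.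
Proof.
apply: (bigdprod_cycles (V := normalized_units_group F gT)).
- exact: abelian_normalized_units.
- exact: basis_unit_in.
- exact: normalized_units_sub_gen.
rewrite (eq_bigr _ basis_unit_order) -expn_sum /= (card_normalized_units p_pr cardF pG cG).
by rewrite leq_exp2l ?prime_gt1 // -card_exponents sum_exponents_le //; exact: basis_unit_lt.
Qed.

(** A trivial generator would make the count of exponent vectors strict, leaving the product of the
    orders below |V(FG)|. *)
Lemma basis_unit_neq1 al : al \in L -> basis_unit al != 1%g.
Proof.
move=> La; apply/eqP=> w1.
have := bigdprod_card (G := normalized_units_group F gT) dprod_basis_unit.
under eq_bigr do rewrite -orderE.
rewrite (eq_bigr _ basis_unit_order) -expn_sum /= (card_normalized_units p_pr cardF pG cG) => /eqP.
rewrite eqn_exp2l ?prime_gt1 // -card_exponents.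
have /(_ al La) := sum_exponents_lt p_pr (e := fun al => logn p #[basis_unit al]%g)
  basis_unit_lt.
by rewrite w1 order1 logn1 => /(_ erefl) lt /eqP e; rewrite e ltnn in lt.
Qed.

Lemma basis_unit_unitary al : al \in Lset1 p l a ->
  basis_unit al \in unitary_units F eta.
Proof.
rewrite inE => /andP[La lo]; rewrite inE basis_unit_in //= -/(val _).
rewrite val_basis_unit //= lo; set u := ualpha F al.
have uu : u \is a GRing.unit := ualpha_unit La.
have usu : star u \is a GRing.unit.
  by apply: (normalized_unit p_pr cardF pG cG); rewrite aug_circledast (aug_ualpha F La).
rewrite (circledastM etaM etaK) (circledastV etaM etaK) // (circledastK etaK).
by rewrite invrM ?unitrV // invrK.
Qed.

(** On L_0 only generators fixed by eta occur in the monomial; on L_2 the unit is a product of the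
    form (star u) u. *)
Lemma basis_unit_symmetric al : al \in L -> ~~ odd (lsum l al) ->
  basis_unit al \in symmetric_units F eta.
Proof.
move=> La le; rewrite inE basis_unit_in //= -/(val _).
rewrite val_basis_unit //= (negPf le); case: ifP => [/eqP l0|_]; last first.
  by rewrite (circledastM etaM etaK) (circledastK etaK) (galg_comm cG).
rewrite (ualphaE F cG al).
rewrite (circledastD etaK) (circledast1 _ etaM etaK).
rewrite /monomial star_prod; apply/eqP; congr (1 + _); apply: eq_bigr => i _.
rewrite (circledastX etaM etaK) star_gvar /star_factor.
case: ltnP => il; last by rewrite mul1r.
have /eqP: lsum l al = 0%N by [].
by rewrite sum_nat_eq0 => /forallP/(_ i)/implyP/(_ il)/eqP->; rewrite !expr0.
Qed.

Lemma Lset_split :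
  L = Lset1 p l a :|: (Lset2 p l a :|: Lset0 p l a).
Proof.
apply/setP=> al; rewrite !in_setU [al \in Lset1 _ _ _]inE [al \in Lset2 _ _ _]inE.
rewrite [al \in Lset0 _ _ _]inE; case: (al \in L) => //=.
by case: odd => //=; rewrite lt0n orNb.
Qed.

Lemma Lset_disjoint : [disjoint Lset1 p l a & Lset2 p l a :|: Lset0 p l a].
Proof.
rewrite disjoint_subset; apply/subsetP=> al; rewrite inE => /andP[La lo].
by rewrite !inE lo /= andbF /= negb_and; case: lsum lo => // n; rewrite orbT.
Qed.

Lemma bigdprod_basis_unit_sub (S : {group {unit galg F gT}}) (B : {set exponents a})
    (H : {group {unit galg F gT}}) :
  (forall al, al \in B -> basis_unit al \in S) ->
  \big[dprod/1%g]_(al in B) <[basis_unit al]>%g = H -> H \subset S.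
Proof.
move=> sB dH; rewrite -(bigdprodWY dH) gen_subG.
by apply/bigcupsP=> al /sB; rewrite cycle_subG.
Qed.

(** The partial products over L_1 and over the union of L_2 and L_0 lie in the unitary and symmetric
    groups; as these meet trivially, comparing orders gives equality. *)
Lemma bigdprod_unitary_symmetric :
  \big[dprod/1%g]_(al in Lset1 p l a) <[basis_unit al]>%g = unitary_units F eta
  /\ \big[dprod/1%g]_(al in Lset2 p l a :|: Lset0 p l a) <[basis_unit al]>%g
     = symmetric_units F eta.
Proof.
have dV := dprod_basis_unit.
rewrite Lset_split (bigdprod_setU _ Lset_disjoint) in dV.
have [[A B eA eB] _ _ _]  := dprodP dV; rewrite eA eB in dV *.
have sA : A \subset unitary_units_group F cG etaM etaK.
  by apply: bigdprod_basis_unit_sub eA => al /basis_unit_unitary.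
have sB : B \subset symmetric_units_group F etaM etaK.
  apply: bigdprod_basis_unit_sub eB => al; rewrite in_setU => Lal.
  apply: basis_unit_symmetric; case/orP: Lal; rewrite inE; case/andP=> // La.
    by case/andP.
  by move/eqP->.
apply: (dprod_split_card (V := normalized_units_group F gT) dV sA sB).
- exact: unitary_sub.
- exact: symmetric_sub.
- exact: (unitary_symmetric_TI p_pr p_odd cardF pG cG etaM etaK).
Qed.

Lemma dprod_unitary_symmetric :
  unitary_units F eta \x symmetric_units F eta = V.
Proof.
have [<- <-] := bigdprod_unitary_symmetric.
by rewrite -[RHS]dprod_basis_unit Lset_split (bigdprod_setU _ Lset_disjoint).
Qed.

Lemma is_basis_unitary :
  is_basis (unitary_units F eta)
    [seq to_unit (star (ualpha F al) * (ualpha F al)^-1) | al in Lset1 p l a].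
Proof.
have -> : [seq to_unit (star (ualpha F al) * (ualpha F al)^-1) | al in Lset1 p l a]
    = [seq basis_unit al | al in Lset1 p l a].
  apply/eq_in_map=> al; rewrite mem_enum inE => /andP[_ lo].
  by rewrite /basis_unit lo.
apply: (is_basis_intro (H := unitary_units_group F cG etaM etaK)).
  apply/imageP=> -[al]; rewrite inE => /andP[La _] /esym/eqP.
  exact/negP/basis_unit_neq1.
by rewrite big_image; have [->] := bigdprod_unitary_symmetric.
Qed.

Lemma is_basis_symmetric :
  is_basis (symmetric_units F eta)
    ([seq to_unit (star (ualpha F al) * ualpha F al) | al in Lset2 p l a]
     ++ [seq to_unit (ualpha F al) | al in Lset0 p l a]).
Proof.
have -> : [seq to_unit (star (ualpha F al) * ualpha F al) | al in Lset2 p l a]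
    = [seq basis_unit al | al in Lset2 p l a].
  apply/eq_in_map=> al; rewrite mem_enum inE => /and3P[_ le l0].
  by rewrite /basis_unit (negPf le) eqn0Ngt l0.
have -> : [seq to_unit (ualpha F al) | al in Lset0 p l a]
    = [seq basis_unit al | al in Lset0 p l a].
  apply/eq_in_map=> al; rewrite mem_enum inE => /andP[_ /eqP l0].
  by rewrite /basis_unit l0.
apply: (is_basis_intro (H := symmetric_units_group F etaM etaK)).
  rewrite mem_cat negb_or; apply/andP; split; apply/imageP=> -[al];
    rewrite inE => /andP[La _] /esym/eqP; exact/negP/basis_unit_neq1.
rewrite big_cat /= !big_image /= -bigdprod_setU; first by have [_ ->] := bigdprod_unitary_symmetric.
rewrite disjoint_subset; apply/subsetP=> al; rewrite inE => /and3P[_ _ l0].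
by rewrite !inE negb_and -lt0n l0 orbT.
Qed.

End Basis.

(** * Numbers of cyclic factors and bases of the unitary and symmetric units *)

Theorem mainTheorem1 (p : nat) (F : finFieldType) (gT : finGroupType)
    (eta : {perm gT}) (l t : nat) (a : 'I_t -> gT) :
  prime p -> odd p -> #|F| = p ->
  p.-group [set: gT] -> abelian [set: gT] ->
  eta \in Aut [set: gT] -> #[eta]%g = 2%N ->
  (l <= t)%N ->
  \big[dprod/1%g]_(i < t) <[a i]>%g = [set: gT] ->
  (forall i : 'I_t, (i < l)%N -> eta (a i) = (a i)^-1%g) ->
  (forall i : 'I_t, (l <= i)%N -> eta (a i) = a i) ->
  let G k : rat := #|pow_set [set: gT] (p ^ k)|%:R in
  let Geta k : rat := #|pow_set (fixed_set eta) (p ^ k)|%:R in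
  let u (alpha : exponents a) := ualpha F alpha in
  let ustar (alpha : exponents a) := circledast eta (u alpha) in
  let Vst := unitary_units F eta in
  let Sst := symmetric_units F eta in
  ((forall (s : seq {unit galg F gT}) (i : nat),
       is_basis Vst s -> (1 <= i)%N ->
       (nb_factors s (p ^ i))%:R =
         1 / 2 * (G i.-1 - 2 * G i + G i.+1
                  - Geta i.-1 + 2 * Geta i - Geta i.+1))
   /\ is_basis Vst
        [seq to_unit (ustar alpha * (u alpha)^-1) | alpha in Lset1 p l a])
  /\
  ((forall (s : seq {unit galg F gT}) (i : nat),
       is_basis Sst s -> (1 <= i)%N ->
       (nb_factors s (p ^ i))%:R =
         1 / 2 * (G i.-1 - 2 * G i + G i.+1
                  + Geta i.-1 - 2 * Geta i + Geta i.+1))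
   /\ is_basis Sst
        ([seq to_unit (ustar alpha * u alpha) | alpha in Lset2 p l a]
         ++ [seq to_unit (u alpha) | alpha in Lset0 p l a])).
Proof.
move=> p_pr p_odd cardF pG cG Aeta eta2 _ dG eta_inv eta_fix G Geta u ustar Vst Sst.
have etaM : {morph eta : g h / (g * h)%g}.
  by move=> g h; apply: (morphicP (Aut_morphic Aeta)); rewrite inE.
have etaK : involutive eta.
  by move=> g; rewrite -permM -expg2 -eta2 expg_order perm1.
have dV := dprod_unitary_symmetric p_pr p_odd cardF pG cG etaM etaK dG eta_inv eta_fix.
have pV := pgroup_normalized_units p_pr cardF pG cG.
have cV := abelian_normalized_units F cG.
split; split.
- move=> s i bs i_gt0.
  have sV := unitary_sub F eta.
  have nb : (nb_factors s (p ^ i) + 2 * logn p #|pow_set Vst (p ^ i)|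
     = logn p #|pow_set Vst (p ^ i.-1)| + logn p #|pow_set Vst (p ^ i.+1)|)%N.
    exact: (nb_factorsE (H := unitary_units_group F cG etaM etaK) p_pr
      (pgroupS sV pV) (abelianS sV cV) bs i_gt0).
  have lE k : (2 * logn p #|pow_set Vst (p ^ k)|
   + #|pow_set (fixed_set eta) (p ^ k)| = #|pow_set [set: gT] (p ^ k)|)%N.
    exact: (logn_pow_unitary p_pr p_odd cardF pG cG etaM etaK dV).
  have e0 := lE i.-1; have e1 := lE i; have e2 := lE i.+1.
  (* Eliminating the logarithms at i - 1, i and i + 1 gives an identity free of subtraction, which
     can be cast exactly to the rationals. *)
  have E : (2 * nb_factors s (p ^ i) + #|pow_set (fixed_set eta) (p ^ i.-1)|
      + #|pow_set (fixed_set eta) (p ^ i.+1)| + 2 * #|pow_set [set: gT] (p ^ i)|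
    = #|pow_set [set: gT] (p ^ i.-1)| + #|pow_set [set: gT] (p ^ i.+1)|
      + 2 * #|pow_set (fixed_set eta) (p ^ i)|)%N by lia.
  rewrite !mul2n -!addnn in E; have := congr1 (fun n => n%:R : rat) E; rewrite !natrD.
  by rewrite -!/(G _) -!/(Geta _) => ?; lra.
- exact: is_basis_unitary.
- move=> s i bs i_gt0.
  have sV := symmetric_sub F eta.
  have nb : (nb_factors s (p ^ i) + 2 * logn p #|pow_set Sst (p ^ i)|
     = logn p #|pow_set Sst (p ^ i.-1)| + logn p #|pow_set Sst (p ^ i.+1)|)%N.
    exact: (nb_factorsE (H := symmetric_units_group F etaM etaK) p_pr
      (pgroupS sV pV) (abelianS sV cV) bs i_gt0).
  have lE k : (2 * (logn p #|pow_set Sst (p ^ k)|).+1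
   = #|pow_set [set: gT] (p ^ k)| + #|pow_set (fixed_set eta) (p ^ k)|)%N.
    exact: (logn_pow_symmetric p_pr p_odd cardF pG cG etaM etaK dV).
  have e0 := lE i.-1; have e1 := lE i; have e2 := lE i.+1.
  have E : (2 * nb_factors s (p ^ i) + 2 * #|pow_set [set: gT] (p ^ i)|
      + 2 * #|pow_set (fixed_set eta) (p ^ i)|
    = #|pow_set [set: gT] (p ^ i.-1)| + #|pow_set [set: gT] (p ^ i.+1)|
      + #|pow_set (fixed_set eta) (p ^ i.-1)|
      + #|pow_set (fixed_set eta) (p ^ i.+1)|)%N by lia.
  rewrite !mul2n -!addnn in E; have := congr1 (fun n => n%:R : rat) E; rewrite !natrD.
  by rewrite -!/(G _) -!/(Geta _) => ?; lra.
- exact: is_basis_symmetric.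
Qed.
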